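(* Let $p<q$ be primes and let $G$ be a finite group. (1) Suppose $|G|=pq^2$. Then $G$ is capable if and only if $|Z(G)|=1$. (2) Suppose $|G|=p^2q$. Then $G$ is capable if and only if $|Z(G)|=1$ or $G\cong C_p\times (C_q\rtimes C_p)$, where $C_q\rtimes C_p$ denotes the non-abelian semidirect product.
   Context: A group $G$ is called capable if there exists a group $H$ such that $G\cong H/Z(H)$. All groups here (including $H$) are finite. $Z(G)$ denotes the center of $G$ and $C_n$ the cyclic group of order $n$. The non-abelian semidirect product $C_q\rtimes C_p$ (the non-abelian group of order $pq$, unique up to isomorphism) exists only when $p$ divides $q-1$; otherwise the second alternative in (2) does not occur. *)

(* Defs.v *)
From mathcomp Require Import all_boot all_order all_fingroup all_algebra all_solvable.

Set Implicit Arguments.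
Unset Strict Implicit.
Unset Printing Implicit Defensive.

Local Open Scope group_scope.

Definition capable (gT : finGroupType) (G : {group gT}) : Prop :=
  exists (hT : finGroupType) (H : {group hT}), G \isog H / 'Z(H).

(* [sdprod_by to] is the external semidirect product Zp q ><| Zp p along [to].
   For primes p and q all non-abelian choices of [to] give isomorphic groups,
   and there is none unless p divides q - 1. *)
Definition isog_cyclic_prod_nonabelian_sdprod (p q : nat)
    (gT : finGroupType) (G : {group gT}) : Prop :=
  exists to : groupAction (Zp p) (Zp q),
    ~~ abelian [set: sdprod_by to] /\
    G \isog setX (Zp p) [set: sdprod_by to].

(* Main.v *)
From HB Require Import structures.
Require Import Defs.
From mathcomp Require Import all_boot all_order all_fingroup all_algebra all_solvable.
From mathcomp Require Import ring.

(* Suppose [G = H / Z(H)] and [1 <> g \in Z(G)] lifts to [x] in [H]. Then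
   [h |-> [x, h]] is a morphism from [H] to [Z(H)], killed by the order of [g]
   and trivial on the lift of any [y] with [g] a power of [y]. It thus yields a
   proper normal subgroup [K] of [G], containing every root of [g], with [G / K]
   of exponent dividing [#[g]]. If [g] has prime order [r], then [r] divides both
   [#|K|] and [#|G : K|]. So when [#|G| = r ^ 2 * s] and [Z(G) <> 1], the centre
   is an [r]-group and [K] is abelian of order [r * s], with a subgroup [<[c]>] of
   order [s] normal in [G].
   - If [s < r], the class of [c] has fewer than [r] elements and a size dividing
     [r], so [c] is central, which is absurd.
   - If [r < s], an [r]-element [b] outside [K] has order [r], because [K]
     contains the roots of [g], and [G] is the direct product of [<[g]>] and the
     non-abelian [<[c]> ><| <[b]>].
   Conversely, [C_p \x F] with [F] centreless and [chi : F -> 'Z_p] nontrivial is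
   the central quotient of the extension of ['Z_p * F] by ['Z_p] given by the
   bilinear cocycle [((u, f), (u', f')) |-> chi f * u']. *)

Set Implicit Arguments.
Unset Strict Implicit.
Unset Printing Implicit Defensive.

Import GroupScope.

(** * Groups of order [p * q] and semidirect products of cyclic groups *)

Lemma mul_primes_center1 (gT : finGroupType) (G : {group gT}) (p q : nat) :
    prime p -> prime q -> #|G| = (p * q)%N -> ~~ abelian G -> 'Z(G) = 1.
Proof.
move=> pp pq oG nabG; apply/eqP; apply: contraR nabG; rewrite trivg_card1 => Z1.
apply: cyclic_center_factor_abelian.
have : (#|'Z(G)| * #|G / 'Z(G)| = p * q)%N.
  by rewrite -oG card_quotient ?Lagrange ?center_sub ?normal_norm ?center_normal.
(* A prime divisor [t] of [#|'Z(G)|] is [p] or [q], so [#|G / 'Z(G)|] divides the other prime and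
   [G / 'Z(G)] is cyclic. *)
have tZ := pdiv_dvd #|'Z(G)|; have := @pdiv_prime #|'Z(G)|.
rewrite ltn_neqAle eq_sym Z1 cardG_gt0 => /(_ isT).
move: (pdiv _) tZ => t /dvdnP[m ->] pt oGZ.
have : t %| p * q by rewrite -oGZ mulnAC dvdn_mull.
rewrite Euclid_dvdM // !dvdn_prime2 //.
have sub_prime s : prime s -> (m * #|G / 'Z(G)| = s)%N -> cyclic (G / 'Z(G)).
  move=> ps ms; have: #|G / 'Z(G)| %| s by rewrite -ms dvdn_mull.
  case/primeP: (ps) => _ sP /sP/pred2P[oq | oq].
    by rewrite (card1_trivg oq) cyclic1.
  by rewrite prime_cyclic // oq.
have tm : (t * (m * #|G / 'Z(G)|) = p * q)%N by rewrite -oGZ mulnCA mulnA.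
case/orP=> /eqP tE; rewrite tE in tm.
  by apply: (sub_prime q) => //; apply/eqP; rewrite -(eqn_pmul2l (prime_gt0 pp)) tm.
by apply: (sub_prime p) => //; apply/eqP; rewrite -(eqn_pmul2l (prime_gt0 pq)) tm mulnC.
Qed.

Lemma card_sdprod_by (aT rT : finGroupType) (D : {group aT}) (R : {group rT})
    (to : groupAction D R) : #|[set: sdprod_by to]| = (#|R| * #|D|)%N.
Proof.
rewrite -(sdprod_card (sdprod_sdpair to)) card_injm ?injm_sdpair1 //.
by rewrite card_injm ?injm_sdpair2.
Qed.

(** The action is conjugation read on exponents through [Zpm]. As [c] and [b] are nontrivial, [Zp
    #[c]] and [Zp #[b]] fill their types; this would fail at order 1, since ['Z_1] has two
    elements. *)
Lemma isog_sdprod_by_cycles (gT : finGroupType) (G : {group gT}) (c b : gT) :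
    c != 1 -> b != 1 -> <[c]> ><| <[b]> = G ->
  exists to : groupAction (Zp #[b]) (Zp #[c]), [set: sdprod_by to] \isog G.
Proof.
move=> c1 b1 /sdprodP[_ defG nbc tibc].
have ZT (a : gT) (i : 'Z_#[a]) : a != 1 -> i \in Zp #[a].
  by move=> a1; rewrite /Zp order_gt1 a1 inE.
have inC x a : Zpm (a := c) x ^ Zpm (a := b) a \in Zpm (a := c) @* Zp #[c].
  by rewrite im_Zpm memJ_norm ?mem_cycle ?(subsetP nbc) ?mem_cycle.
pose to (x : 'Z_#[c]) (a : 'Z_#[b]) : 'Z_#[c] :=
  invm (injm_Zpm c) (Zpm (a := c) x ^ Zpm (a := b) a).
have toE x a : Zpm (a := c) (to x a) = Zpm (a := c) x ^ Zpm (a := b) a.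
  by rewrite invmK.
have injc : injective (Zpm (a := c)).
  by move=> x y; apply: (injmP (injm_Zpm c)); apply: ZT.
have to_action : is_action (Zp #[b]) to.
  split=> [a x y /(congr1 (@Zpm _ c)) | x a d Da Dd].
    by rewrite !toE => /conjg_inj/injc.
  by apply: injc; rewrite !toE -conjgM -(ZpmM Da Dd).
pose act := Action to_action.
have to_gaction : is_groupAction (Zp #[c]) act.
  move=> a Da; rewrite inE; apply/andP; split.
    by apply/subsetP=> x _; apply: ZT.
  apply/morphicP=> x y _ _; rewrite !actpermE /=; apply: injc.
  by rewrite (ZpmM (ZT _ _ c1) (ZT _ _ c1)) !toE (ZpmM (ZT _ _ c1) (ZT _ _ c1)) conjMg.
pose gact := GroupAction to_gaction; exists gact.
have compat : {in Zp #[c] & Zp #[b], morph_act gact 'J (@Zpm _ c) (@Zpm _ b)}.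
  by move=> x a _ _; apply: toE.
apply/isogP; exists [morphism of xsdprodm compat].
  by rewrite injm_xsdprodm !injm_Zpm !im_Zpm tibc /=.
by rewrite im_xsdprodm !im_Zpm.
Qed.

Lemma capable_center1 (gT : finGroupType) (G : {group gT}) :
  'Z(G) = 1 -> capable G.
Proof. by move=> Z1; exists gT, G; rewrite Z1 quotient1_isog. Qed.

Lemma capable_isog (gT rT : finGroupType) (G : {group gT}) (L : {group rT}) :
  G \isog L -> capable L -> capable G.
Proof. by move=> iGL [hT [H iLH]]; exists hT, H; apply: isog_trans iLH. Qed.

(** * Central extension by a bilinear cocycle *)

Section CocycleExtension.

Variables (n : nat) (gT : finGroupType) (chi : gT -> 'Z_n).
Hypothesis chiM : {morph chi : f g / f * g >-> (f + g)%R}.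

(** In [(u, v, f)] the middle entry [v] is the coordinate of the central kernel. The morphism
    property is a parameter of the type so that the group structure attached to the type can recover
    [chi]. *)
Definition cocycle_ext of {morph chi : f g / f * g >-> (f + g)%R} : Type :=
  ('Z_n * 'Z_n * gT)%type.
Local Notation extT := (cocycle_ext chiM).

HB.instance Definition _ := Finite.on extT.

Definition cocycle_one : extT := (0%R, 0%R, 1).
Definition cocycle_mul (x y : extT) : extT :=
  ((x.1.1 + y.1.1)%R, (x.1.2 + y.1.2 + chi x.2 * y.1.1)%R, x.2 * y.2).
Definition cocycle_inv (x : extT) : extT :=
  ((- x.1.1)%R, (- x.1.2 + chi x.2 * x.1.1)%R, x.2^-1).

Lemma cocycle_chi1 : chi 1 = 0%R.
Proof. by apply: (GRing.addrI (chi 1)); rewrite -chiM mulg1 GRing.addr0. Qed.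

Lemma cocycle_mulA : associative cocycle_mul.
Proof.
move=> [[u v] f] [[u' v'] f'] [[u'' v''] f'']; congr (_, _, _) => /=.
- exact: GRing.addrA.
- by rewrite chiM; ring.
- exact: mulgA.
Qed.

Lemma cocycle_mul1 : left_id cocycle_one cocycle_mul.
Proof.
move=> [[u v] f]; congr (_, _, _) => /=; rewrite ?GRing.add0r ?mul1g //.
by rewrite cocycle_chi1 GRing.mul0r GRing.addr0.
Qed.

Lemma cocycle_mulV : left_inverse cocycle_one cocycle_inv cocycle_mul.
Proof.
move=> [[u v] f]; congr (_, _, _) => /=; rewrite ?GRing.addNr ?mulVg //.
have -> : chi f^-1 = (- chi f)%R.
  by apply: (GRing.addrI (chi f)); rewrite -chiM mulgV cocycle_chi1 GRing.subrr.
by rewrite GRing.mulNr GRing.addrAC GRing.addrK GRing.addNr.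
Qed.

HB.instance Definition _ :=
  Finite_isGroup.Build extT cocycle_mulA cocycle_mul1 cocycle_mulV.

Definition cocycle_proj (x : extT) : 'Z_n * gT := (x.1.1, x.2).

Lemma cocycle_projM : {in [set: extT] &, {morph cocycle_proj : x y / x * y}}.
Proof. by []. Qed.

Canonical cocycle_proj_morphism := Morphism cocycle_projM.

(** Commuting with every [(0, 0, g)] forces [f = 1]. Commuting with [(0, 0, f1)] then compares [v]
    with [v + chi f1 * u = v + u], so [u = 0]. *)
Lemma center_cocycle_ext (f1 : gT) :
  chi f1 = 1%R -> 'Z([set: gT]) = 1 -> 'Z([set: extT]) = 'ker cocycle_proj.
Proof.
move=> chif1 Z1; apply/setP=> -[[u v] f]; apply/idP/idP.
  case/setIP=> _ /centP cx; apply/kerP; rewrite ?inE //.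
  have f_1 : f = 1.
    apply/set1P; rewrite -[[set _]]Z1 inE inE; apply/centP=> g _.
    by have := cx (0%R, 0%R, g) (in_setT _) => /(congr1 snd).
  have := cx (0%R, 0%R, f1) (in_setT _) => /(congr1 (snd \o fst)) /=.
  rewrite f_1 cocycle_chi1 chif1 GRing.mul0r GRing.mul1r !GRing.addr0 GRing.add0r.
  move/(congr1 (fun w => w - v)%R); rewrite GRing.subrr GRing.addrAC GRing.subrr.
  by rewrite GRing.add0r /cocycle_proj /= => <-.
move/(kerP _ (in_setT _)) => [-> ->]; rewrite inE inE; apply/centP=> -[[u' v'] f'] _.
congr (_, _, _) => /=; rewrite ?mul1g ?mulg1 ?GRing.add0r ?GRing.addr0 //.
by rewrite cocycle_chi1 GRing.mul0r GRing.mulr0 !GRing.addr0 GRing.addrC.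
Qed.

Lemma capable_prod_Zp (f1 : gT) :
  chi f1 = 1%R -> 'Z([set: gT]) = 1 -> capable [set: 'Z_n * gT].
Proof.
move=> chif1 Z1; exists extT, [set: extT]; rewrite (center_cocycle_ext chif1 Z1).
have imE : cocycle_proj @* [set: extT] = [set: 'Z_n * gT].
  apply/setP=> -[u f]; rewrite inE; apply/morphimP.
  by exists (u, 0%R, f); rewrite ?inE.
by rewrite isog_sym; have := first_isog [morphism of cocycle_proj]; rewrite imE.
Qed.

End CocycleExtension.

Lemma capable_cyclic_prod_nonabelian_sdprod (p q : nat)
    (gT : finGroupType) (G : {group gT}) :
    prime p -> prime q -> isog_cyclic_prod_nonabelian_sdprod p q G -> capable G.
Proof.
move=> pp pq [to [nab iG]]; apply: capable_isog iG _.
have ZpT : Zp p = setT by rewrite /Zp prime_gt1.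
have -> : setX_group (Zp_group p) [set: sdprod_by to]%G = [set: 'Z_p * sdprod_by to]%G.
  by apply/val_inj/setP=> -[a x]; rewrite !inE /= ZpT inE.
(* Here [1%R] generates [Zp p], whereas the second [1] is the identity of [Zp q]. The character
   [chi] is the projection onto the acting factor [Zp p]. *)
have f1P : (1%R, 1) \in setX (Zp p) (Zp q) by rewrite inE /= ZpT inE group1.
apply: (@capable_prod_Zp _ _ (fun u : sdprod_by to => u.1) _ (SdPair to f1P)) => //.
apply: (mul_primes_center1 pq pp) => //.
by rewrite card_sdprod_by !card_Zp ?prime_gt0.
Qed.

(** * Central elements of a capable group *)

Lemma capable_central_elem (gT : finGroupType) (G : {group gT}) (g : gT) :
    capable G -> g \in 'Z(G) -> g != 1 ->
  exists K : {group gT},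
    [/\ K <| G, ~~ (G \subset K), abelian (G / K), exponent (G / K) %| #[g]
      & {in G, forall y, g \in <[y]> -> y \in K}].
Proof.
move=> [hT [H /isogP[f injf fG]]] Zg g1.
have Gg : g \in G by case/setIP: Zg.
have : f g \in 'Z(H / 'Z(H)) by rewrite -fG -injm_center // mem_morphim.
case/setIP=> /morphimP[x Nx Hx fg] cfg.
have nZ h : h \in H -> h \in 'N('Z(H)).
  exact: (subsetP (normal_norm (center_normal H))).
have Zx h : h \in H -> [~ x, h] \in 'Z(H).
  move=> Hh; apply: coset_idr; first by rewrite groupR ?nZ.
  rewrite morphR ?nZ //=; apply/eqP/commgP; rewrite -fg.
  by apply: (centP cfg); rewrite mem_quotient.
have phiM : {in H &, {morph (fun h => [~ x, h]) : h k / h * k}}.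
  move=> h k Hh Hk; rewrite commgMJ.
  have /setIP[_ /centP cxh] := Zx h Hh.
  have /setIP[Hxk _] := Zx k Hk.
  by rewrite (conjgE _ k) cxh ?mulKg ?(centP cxh) // (cxh _ Hxk).
pose phi := Morphism phiM.
have kerE : 'ker phi = 'C_H[x].
  apply/setP=> h; rewrite 2!in_setI; congr (_ && _).
  by rewrite in_set in_set1; apply/commgP/cent1P => /commute_sym.
have nC : 'C_H[x] <| H by rewrite -kerE ker_normal.
have abHC : abelian (H / 'C_H[x]).
  rewrite -kerE (isog_abelian (first_isog phi)).
  apply: abelianS (center_abelian H).
  by apply/subsetP=> _ /morphimP[h _ Hh ->]; apply: Zx.
(* With [n = #[g]], [[~ x, h ^+ n] = [~ x, h] ^+ n = [~ x ^+ n, h]], which is trivial because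
   [x ^+ n] maps to [f (g ^+ n) = 1]. *)
have powC h : h \in H -> h ^+ #[g] \in 'C_H[x].
  move=> Hh; rewrite -kerE; apply/kerP; rewrite ?groupX //.
  rewrite morphX //= -commXg; last first.
    by have /setIP[_ /centP cxh] := Zx h Hh; apply/esym/cxh.
  have Zxn : x ^+ #[g] \in 'Z(H).
    apply: coset_idr; first by rewrite groupX.
    by rewrite morphX //= -fg -morphX // expg_order morph1.
  by apply/eqP/commgP; case/setIP: Zxn => _ /centP cxn; apply: cxn.
(* [K] consists of the elements of [G] whose lifts to [H] commute with [x]; the choice of lift is
   immaterial because lifts differ by central elements. *)
pose K := f @*^-1 ('C_H[x] / 'Z(H)).
have KP y h : y \in G -> h \in H -> f y = coset 'Z(H) h -> h \in 'C_H[x] ->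
    y \in K.
  by move=> Gy Hh fy Ch; apply/morphpreP; rewrite fy mem_quotient.
have liftG y : y \in G -> exists2 h, h \in H & f y = coset 'Z(H) h.
  move=> Gy; have : f y \in H / 'Z(H) by rewrite -fG mem_morphim.
  by case/morphimP=> h _ Hh ->; exists h.
have nKG : K <| G.
  have EG : f @*^-1 (H / 'Z(H)) = G by rewrite -fG morphimGK ?(trivgP injf) ?sub1G.
  by rewrite -[X in _ <| X]EG morphpre_normal ?fG ?quotientS ?subsetIl ?quotient_normal.
exists K; split=> //.
- apply: contra g1 => sGK; rewrite -(morph_injm_eq1 injf) // fg.
  have sHC : H \subset 'C_H[x].
    have sZC : 'Z(H) \subset 'C_H[x] by rewrite setIS // -cent_set1 centS ?sub1set.
    rewrite -(quotientSGK _ sZC) ?normal_norm ?center_normal // -fG.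
    apply/subsetP=> _ /morphimP[y _ Gy ->].
    by have /morphpreP[] := subsetP sGK y Gy.
  apply/eqP/coset_id; rewrite inE Hx; apply/centP=> h Hh.
  by have /setIP[_ /cent1P] := subsetP sHC h Hh.
- apply: sub_der1_abelian; apply/subsetP=> y G'y.
  have Gy : y \in G := subsetP (der_sub 1 G) y G'y.
  have : f y \in (H / 'Z(H))^`(1) by rewrite -fG -morphim_der // mem_morphim.
  rewrite -quotient_der ?normal_norm ?center_normal // => /morphimP[h _ H'h fy].
  apply: (KP y h) => //; first exact: (subsetP (der_sub 1 H)).
  by rewrite (subsetP _ _ H'h) // der1_min ?normal_norm.
- apply/exponentP=> _ /morphimP[y Ny Gy ->].
  rewrite -morphX //; apply: coset_id.
  have [h Hh fy] := liftG y Gy.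
  apply: (KP _ (h ^+ #[g])); rewrite ?(groupX _ Gy) ?(groupX _ Hh) ?powC //.
  by rewrite morphX // fy -morphX ?nZ.
move=> y Gy /cycleP[n gy]; have [h Hh fy] := liftG y Gy.
apply: (KP y h) => //; rewrite inE Hh; apply/cent1P.
(* As [g = y ^+ n], the elements [x] and [h ^+ n] lift the same element, so [x] is a central element
   times a power of [h]. *)
have : x * h ^- n \in 'Z(H).
  apply: coset_idr; first by rewrite groupM ?groupV ?groupX ?nZ.
  by rewrite morphM ?morphV ?morphX ?groupV ?groupX ?nZ //= -fg -fy gy morphX // mulgV.
case/setIP=> _ /centP chx.
have -> : x = (x * h ^- n) * h ^+ n by rewrite mulgKV.
apply: commuteM; first exact/commute_sym/chx.
exact: commuteX.
Qed.

Lemma capable_prime_central_elem (gT : finGroupType) (G : {group gT}) (g : gT) :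
    capable G -> g \in 'Z(G) -> prime #[g] ->
  exists K : {group gT},
    [/\ K <| G, g \in K, (exists k, #|G : K| = (#[g] ^ k.+1)%N)
      & {in G, forall y, g \in <[y]> -> y \in K}].
Proof.
move=> capG Zg pg.
have [|K [nKG nGK _ expK rootK]] := capable_central_elem capG Zg.
  by rewrite -order_gt1 prime_gt1.
exists K; split=> //; first by apply: rootK; rewrite ?cycle_id //; case/setIP: Zg.
have /p_natP[k] : #[g].-nat #|G / K|.
  by rewrite -[_.-nat _]pnat_exponent (pnat_dvd expK) ?pnat_id.
rewrite card_quotient ?normal_norm //; case: k => [|k]; last by exists k.
by move/eqP; rewrite indexg_eq1 (negPf nGK).
Qed.

(** One factor [#[g]] comes from [g \in K], the other from the index of [K]. This excludes central
    elements of a prime order dividing [#|G|] only once. *)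
Lemma capable_central_order_sqr (gT : finGroupType) (G : {group gT}) (g : gT) :
  capable G -> g \in 'Z(G) -> prime #[g] -> #[g] ^ 2 %| #|G|.
Proof.
move=> capG Zg pg.
have [K [nKG Kg [k iK] _]] := capable_prime_central_elem capG Zg pg.
rewrite -(Lagrange (normal_sub nKG)) iK; rewrite expnS expn1.
by rewrite dvdn_mul ?order_dvdG ?dvdn_exp.
Qed.

(** * Capable groups of order [r ^ 2 * s] with nontrivial centre *)

Lemma normal_abelian_mul_primes (gT : finGroupType) (G K : {group gT}) (r s : nat) :
    prime r -> prime s -> r != s -> K <| G -> abelian K -> #|K| = (r * s)%N ->
  exists c : gT, [/\ c \in K, #[c] = s & <[c]> <| G].
Proof.
move=> pr ps neq_rs nKG abK oK.
have [c Kc oc] : {c | c \in K & #[c] = s} by apply: Cauchy; rewrite ?oK ?dvdn_mull.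
(* The [s]-core is characteristic in [K], hence normal in [G]; as [K] is abelian, it is the Sylow
   subgroup, of order [s]. *)
exists c; split=> //; suff -> : <[c]> = 'O_s(K).
  by apply: char_normal_trans nKG; apply: pcore_char.
have sylK : s.-Sylow(K) 'O_s(K) := nilpotent_pcore_Hall s (abelian_nil abK).
apply/eqP; rewrite eqEcard pcore_max /=; last 2 first.
- by rewrite /pgroup -orderE oc pnat_id.
- by rewrite /normal cycle_subG Kc cents_norm // (centsS _ abK) // cycle_subG.
rewrite (card_Hall sylK) oK -orderE oc p_part lognM ?prime_gt0 // !logn_prime //.
by rewrite eqxx eq_sym (negPf neq_rs).
Qed.

(** A central element [g] of prime order must have order [r], and its [K] index [r]. Modulo the
    central [<[g]>], [K] has prime order [s], so [K] is abelian. *)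
Lemma capable_sqr_prime_mul (gT : finGroupType) (G : {group gT}) (r s : nat) :
    prime r -> prime s -> r != s -> #|G| = (r ^ 2 * s)%N ->
    capable G -> 'Z(G) != 1 ->
  exists (g : gT) (K : {group gT}),
    [/\ g \in 'Z(G) /\ #[g] = r, K <| G, #|K| = (r * s)%N, abelian K
      & {in G, forall y, g \in <[y]> -> y \in K}].
Proof.
move=> pr ps neq_rs oG capG; rewrite trivg_card1 => Z1.
have pt : prime (pdiv #|'Z(G)|).
  by rewrite pdiv_prime // ltn_neqAle eq_sym Z1 cardG_gt0.
have [g Zg og] := Cauchy pt (pdiv_dvd _); rewrite -og in pt.
have [K [nKG Kg [k iK] rootK]] := capable_prime_central_elem capG Zg pt.
have dgk : #[g] ^ k.+2 %| #|G|.
  rewrite -(Lagrange (normal_sub nKG)) iK expnS.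
  by rewrite dvdn_pmul2r ?expn_gt0 ?order_gt0 // order_dvdG.
(* The right side is the multiplicity of [#[g]] in [r ^ 2 * s]; it reaches 2 only if [#[g] = r], and
   then [k = 0]. *)
have : k.+2 <= (#[g] == r).*2 + (#[g] == s).
  move: dgk; rewrite pfactor_dvdn ?cardG_gt0 // oG.
  by rewrite lognM ?expn_gt0 ?prime_gt0 // lognX !logn_prime // mul2n.
have [gr | _] := eqVneq #[g] r; last by case: (_ == s).
rewrite gr (negPf neq_rs) addn0 !ltnS leqn0 => /eqP k0.
have oK : #|K| = (r * s)%N.
  apply/eqP; rewrite -(eqn_pmul2r (prime_gt0 pr)) -{1}gr -[#[g]]expn1.
  by rewrite -[in 1%N]k0 -iK Lagrange ?normal_sub // oG mulnAC.
have sgZ : <[g]> \subset 'Z(K).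
  by rewrite cycle_subG inE Kg; case/setIP: Zg => _; apply/subsetP/centS/normal_sub.
exists g, K; split=> //; apply: (cyclic_factor_abelian sgZ); apply: prime_cyclic.
rewrite card_quotient ?(subset_trans _ (cent_sub _)) //; last first.
  by rewrite centsC (subset_trans sgZ) ?subsetIr.
by rewrite -divgS ?(subset_trans sgZ) ?subsetIl // oK -orderE gr mulKn ?prime_gt0.
Qed.

Lemma capable_mul_sqr_center1 (gT : finGroupType) (G : {group gT}) (p q : nat) :
    prime p -> prime q -> p < q -> #|G| = (p * q ^ 2)%N -> capable G -> 'Z(G) = 1.
Proof.
move=> pp pq ltpq oG capG; apply/eqP; apply: contraT => nZ1.
have neq_qp : q != p by rewrite gtn_eqF.
have oG' : #|G| = (q ^ 2 * p)%N by rewrite oG mulnC.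
have [g [K [_ nKG oK abK _]]] := capable_sqr_prime_mul pq pp neq_qp oG' capG nZ1.
have [c [Kc oc nc]] := normal_abelian_mul_primes pq pp neq_qp nKG abK oK.
have Gc := subsetP (normal_sub nKG) c Kc.
have iK : #|G : K| = q.
  by rewrite -divgS ?normal_sub // oK oG' expnS expn1 -mulnA mulnK ?muln_gt0 ?prime_gt0.
have sKC : K \subset 'C_G[c].
  by rewrite subsetI normal_sub // sub_cent1 (subsetP abK).
have iC : #|G : 'C_G[c]| = 1%N.
  have dC : #|G : 'C_G[c]| %| q by rewrite -iK indexgS.
  case/primeP: (pq) => _ /(_ _ dC)/pred2P[//|iCq].
  (* The class of [c] would have [q] elements, all in the normal subgroup [<[c]>] of order [p]. *)
  have : q <= p.
    rewrite -iCq index_cent1 -oc; apply/subset_leq_card.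
    by rewrite class_sub_norm ?cycle_id // normal_norm.
  by rewrite leqNgt ltpq.
have Zc : c \in 'Z(G).
  rewrite inE Gc -sub_cent1; apply/setIidPl/eqP.
  by rewrite eqEsubset subsetIl -indexg_eq1 iC.
have := capable_central_order_sqr capG Zc; rewrite oc oG => /(_ pp).
rewrite expnS expn1 dvdn_pmul2l ?prime_gt0 // Euclid_dvdX // dvdn_prime2 //.
by rewrite eq_sym (negPf neq_qp).
Qed.

Lemma capable_sqr_mul_isog (gT : finGroupType) (G : {group gT}) (p q : nat) :
    prime p -> prime q -> p < q -> #|G| = (p ^ 2 * q)%N -> capable G -> 'Z(G) != 1 ->
  isog_cyclic_prod_nonabelian_sdprod p q G.
Proof.
move=> pp pq ltpq oG capG nZ1; have neq_pq : p != q by rewrite ltn_eqF.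
have [g [K [[Zg og] nKG oK abK rootK]]] := capable_sqr_prime_mul pp pq neq_pq oG capG nZ1.
have [c [Kc oc nc]] := normal_abelian_mul_primes pp pq neq_pq nKG abK oK.
have /setIP[Gg cGg] := Zg; have Gc := subsetP (normal_sub nKG) c Kc.
have Kg : g \in K by rewrite rootK ?cycle_id.
have co_pq : coprime p q by rewrite prime_coprime // dvdn_prime2.
have pg : p.-group <[g]> by rewrite /pgroup -orderE og pnat_id.
have sgG : <[g]> \subset G by rewrite cycle_subG.
have [P sylP sgP] := Sylow_superset sgG pg.
have oP : #|P| = (p ^ 2)%N.
  rewrite (card_Hall sylP) oG p_part lognM ?expn_gt0 ?prime_gt0 // lognX.
  by rewrite !logn_prime // eqxx (negPf neq_pq).
(* [P] does not fit in [K], since [p ^ 2] does not divide [p * q]. *)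
have [b Pb nKb] : exists2 b, b \in P & b \notin K.
  apply/subsetPn; apply: contraL ltpq => /cardSg; rewrite oP oK expnS expn1.
  by rewrite dvdn_pmul2l ?prime_gt0 // dvdn_prime2 // (negPf neq_pq).
have Gb : b \in G := subsetP (pHall_sub sylP) b Pb.
(* Order [p ^ 2] is impossible: [<[b]>] would be [P], which contains [g], making [b] a root of [g]
   and so an element of [K]. *)
have ob : #[b] = p.
  have : #[b] %| p ^ 2 by rewrite -oP order_dvdG.
  case/(dvdn_pfactor _ _ pp)=> -[|[|[|//]]] _ ob.
  - by case/negP: nKb; rewrite (eqP (_ : b == 1)) ?group1 // -order_eq1 ob.
  - by rewrite ob.
  case/negP: nKb; apply: rootK => //; suff -> : <[b]> = P by rewrite -cycle_subG.
  by apply/eqP; rewrite eqEcard cycle_subG Pb oP -orderE ob leqnn.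
have c1 : c != 1 by rewrite -order_gt1 oc prime_gt1.
have b1 : b != 1 by rewrite -order_gt1 ob prime_gt1.
have nbc : <[b]> \subset 'N(<[c]>).
  by rewrite cycle_subG (subsetP (normal_norm nc)).
have tibc : <[c]> :&: <[b]> = 1.
  by rewrite coprime_TIg // -!orderE oc ob coprime_sym.
pose F := (<[c]> <*> <[b]>)%G.
have defF : <[c]> ><| <[b]> = F by rewrite sdprodEY.
have oF : #|F| = (p * q)%N by rewrite -(sdprod_card defF) -!orderE oc ob mulnC.
have Fc : c \in F by rewrite -cycle_subG joing_subl.
have Fb : b \in F by rewrite -cycle_subG joing_subr.
have sFG : F \subset G by rewrite join_subG !cycle_subG Gc.
(* Otherwise [F :&: K] would contain both [g] and [c], so its order would be [p * q], and [b] would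
   lie in [K]. *)
have nFg : g \notin F.
  apply: contra nKb => Fg; apply: (subsetP _ b Fb).
  apply/setIidPl/eqP; rewrite eqEcard subsetIl oF dvdn_leq ?cardG_gt0 //.
  by rewrite Gauss_dvd // -{1}og -oc !order_dvdG // inE ?Fg ?Fc.
have tigF : <[g]> :&: F = 1 by rewrite prime_TIg -?orderE ?og // cycle_subG.
have cgF : F \subset 'C(<[g]>).
  by rewrite centsC cycle_subG (subsetP (centS sFG)).
have defG : <[g]> \x F = G.
  rewrite dprodE //; apply/eqP; rewrite eqEcard mul_subG ?cycle_subG //.
  by rewrite /= TI_cardMg // oG -orderE og oF mulnA mulnn leqnn.
(* If [F] were abelian, so would be [G], and [c] would be central of order [q], although [q ^ 2]
   does not divide [#|G|]. *)
have nabF : ~~ abelian F.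
  apply/negP=> abF; have abG : abelian G.
    have [_ <- _ _] := dprodP defG.
    by rewrite abelianM cycle_abelian abF cgF.
  have Zc : c \in 'Z(G) by rewrite (center_idP abG).
  have := capable_central_order_sqr capG Zc; rewrite oc oG => /(_ pq).
  rewrite [(q ^ 2)%N]expnS expn1 dvdn_pmul2r ?prime_gt0 // Euclid_dvdX // dvdn_prime2 //.
  by rewrite eq_sym (negPf neq_pq).
have [to iF] := isog_sdprod_by_cycles c1 b1 defF.
rewrite ob oc in to iF.
exists to; split; first by rewrite (isog_abelian iF).
apply: isog_dprod defG (setX_dprod _ _) _ _.
  have igp : <[g]> \isog Zp p by rewrite isog_sym -og Zp_isog.
  exact: isog_trans igp (isog_setX1 _ _).
have iFs : F \isog [set: sdprod_by to] by rewrite isog_sym.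
exact: isog_trans iFs (isog_set1X _ _).
Qed.

Theorem theorem2p11 (p q : nat) (gT : finGroupType) (G : {group gT})
    (hp : prime p) (hq : prime q) (hpq : (p < q)%N) :
  (#|G| = (p * q ^ 2)%N ->
    (capable G <-> #|'Z(G)%g| = 1%N)) /\
  (#|G| = (p ^ 2 * q)%N ->
    (capable G <->
      #|'Z(G)%g| = 1%N \/ isog_cyclic_prod_nonabelian_sdprod p q G)).
Proof.
have cap1 : #|'Z(G)| = 1%N -> capable G by move/card1_trivg; apply: capable_center1.
split=> oG; split=> //.
- by move/(capable_mul_sqr_center1 hp hq hpq oG) ->; rewrite cards1.
- move=> capG; have [Z1|/eqP nZ1] := eqVneq #|'Z(G)| 1%N; [by left | right].
  by apply: capable_sqr_mul_isog => //; rewrite trivg_card1; apply/eqP.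
- by case=> //; apply: capable_cyclic_prod_nonabelian_sdprod.
Qed.
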